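(* Let $X$ be a Banach space, $T$ a bounded linear operator on $X$ and $\Lambda \subset (0,+\infty)$ a set with at least two elements. If $\Lambda$ is unbounded or $1/r(T) \geq \inf(\Lambda)$, then $$\bigcap_{\lambda \in \Lambda}FHC(\lambda T)=\emptyset.$$
   Context: $\mathbb{N}=\{0,1,2,\ldots\}$. $r(T)$ is the spectral radius of $T$, $r(T)=\inf_{n\geq 1}\Vert T^n\Vert^{1/n}=\lim_{n\to\infty}\Vert T^n\Vert^{1/n}$, with $1/r(T)$ read as $+\infty$ when $r(T)=0$. $FHC(T)$ is the set of frequently hypercyclic vectors of $T$: those $x\in X$ such that for every non-empty open $U\subset X$, $\underline{d}(\{n\in\mathbb{N}:T^n(x)\in U\})>0$, where $\underline{d}(E)=\liminf_{n\to\infty}\frac{\mathrm{card}([0,n]\cap E)}{n+1}$ for $E\subset\mathbb{N}$. *)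

(* Defs.v *)
From HB Require Import structures.
From mathcomp Require Import all_boot all_order all_algebra.
From mathcomp Require Import complex.
From mathcomp Require Import all_classical all_reals all_analysis.

Set Implicit Arguments.
Unset Strict Implicit.
Unset Printing Implicit Defensive.

Import Order.TTheory GRing.Theory Num.Theory.
Import numFieldNormedType.Exports.

Local Open Scope classical_set_scope.
Local Open Scope ring_scope.

(* Banach spaces are taken over the real or the complex numbers; [scalars]
   selects the field, so that one statement covers both cases. *)
Inductive scalars := RealScalars | ComplexScalars.

Definition scalar_field (R : realType) (k : scalars) : numFieldType :=
  match k with
  | RealScalars => R
  | ComplexScalars => R[i]
  end.

Definition of_real (R : realType) (k : scalars) : R -> scalar_field R k :=
  match k return R -> scalar_field R k with
  | RealScalars => fun r => r
  | ComplexScalars => fun r => r%:C%C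
  end.

Definition to_real (R : realType) (k : scalars) : scalar_field R k -> R :=
  match k return scalar_field R k -> R with
  | RealScalars => fun z => z
  | ComplexScalars => fun z => complex.Re z
  end.

(* In a normed module over R[i] the library's norm is a nonnegative element of
   R[i], hence has zero imaginary part; [rnorm] is the same norm valued in R. *)
Definition rnorm (R : realType) (k : scalars)
    (X : normedModType (scalar_field R k)) (x : X) : R :=
  to_real `|x|.

Definition bounded_operator (R : realType) (k : scalars)
    (X : normedModType (scalar_field R k)) (T : X -> X) : Prop :=
  exists M : R, forall x : X, rnorm (T x) <= M * rnorm x.

Definition opnorm (R : realType) (k : scalars)
    (X : normedModType (scalar_field R k)) (T : X -> X) : R :=
  sup [set rnorm (T x) | x in [set x : X | rnorm x <= 1]].

Definition spectral_radius (R : realType) (k : scalars)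
    (X : normedModType (scalar_field R k)) (T : X -> X) : R :=
  inf [set opnorm (iter n T) `^ (n%:R^-1) | n in [set n : nat | (1 <= n)%N]].

Definition lower_density (R : realType) (E : set nat) : R :=
  limn_inf (fun n : nat =>
    #|[pred i : 'I_n.+1 | (i : nat) \in E]|%:R / n.+1%:R : R).

Definition FHC (R : realType) (X : topologicalType) (f : X -> X) : set X :=
  [set x | forall U : set X, open U -> U !=set0 ->
     0 < lower_density R [set n | U (iter n f x)]].

(* Main.v *)
Require Import Defs.
From HB Require Import structures.
From mathcomp Require Import all_boot all_order all_algebra.
From mathcomp Require Import complex.
From mathcomp Require Import all_classical all_reals all_analysis.
From mathcomp Require Import zify ring lra.

Set Implicit Arguments.
Unset Strict Implicit.
Unset Printing Implicit Defensive.

Import Order.TTheory GRing.Theory Num.Theory.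
Import numFieldNormedType.Exports.

Local Open Scope classical_set_scope.
Local Open Scope ring_scope.

(** Suppose that x is frequently hypercyclic for both lam T and mu T, where
    lam < mu in Lambda.  Write u n for the norm of T^n x.  The times m at which
    mu^m T^m x lies in the open unit ball, and the times n at which lam^n T^n x
    lies outside the closed unit ball, both form sets of positive lower density.
    Such a set meets every window [n/K, n] with n large, for a constant K that
    depends on the set ([lower_density_gt0_visits]).

    At a small time m, u m < mu^-m, so lam^m u m < (lam/mu)^m is geometrically
    small in m.  If the norms of (lam T)^j are at most C q^j with q >= 1, then
    lam^n u n can exceed 1 at a later time n only if
    C q^(n - m) > (mu/lam)^m.  When q^L < mu/lam, this rules out, for
    m large, every n between m and L m ([no_close_visits]).  Hence a
    contradiction as soon as L exceeds the constant K of one of the two sets of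
    times, with a margin for rounding.  That K depends on lam or on mu, so the
    order of choice matters in arranging q^L < mu/lam.

    - If Lambda is unbounded, fix lam.  This fixes q (a bound for the norm of
      lam T) and the constant L of the large times; then take mu > q^L lam.
    - If r(T) inf Lambda <= 1, fix mu > inf Lambda.  This fixes the constant K of
      the small times and hence L; pick q > 1 so close to 1 that q^L < mu/nu for some
      nu between inf Lambda and mu, then lam < nu in Lambda so close to inf Lambda
      that lam r(T) < q.  Letting lam be chosen last is what makes the argument
      work when inf Lambda is not attained: the density of the large times, which
      may degenerate as lam tends to inf Lambda, is never used beyond the fact
      that these times are unbounded. *)

(** * The real-valued norm over the real or complex scalars *)

Lemma of_real_ltE (R : realType) (k : scalars) (a b : R) :
  (of_real k a < of_real k b) = (a < b).
Proof. by case: k => //=; rewrite ltcR. Qed.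

Lemma norm_of_real (R : realType) (k : scalars) (a : R) :
  `|of_real k a| = of_real k `|a|.
Proof. by case: k => //=; rewrite normc_def /= expr0n addr0 sqrtr_sqr. Qed.

Lemma of_real1 (R : realType) (k : scalars) : of_real k (1 : R) = 1.
Proof. by case: k. Qed.

Lemma of_real0 (R : realType) (k : scalars) : of_real k (0 : R) = 0.
Proof. by case: k. Qed.

Lemma of_realM (R : realType) (k : scalars) :
  {morph @of_real R k : a b / a * b}.
Proof. by case: k => //= a b; rewrite rmorphM. Qed.

Lemma of_realK (R : realType) (k : scalars) :
  cancel (@of_real R k) (@to_real R k).
Proof. by case: k. Qed.

Lemma to_realK (R : realType) (k : scalars) (z : scalar_field R k) :
  0 <= z -> of_real k (to_real z) = z.
Proof.
case: k z => //= z; rewrite lecE => /andP[/eqP /= z0 _].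
by case: z z0 => a b /= ->.
Qed.

Lemma to_real_ge0 (R : realType) (k : scalars) (z : scalar_field R k) :
  0 <= z -> 0 <= to_real z.
Proof. by case: k z => //= z; rewrite lecE => /andP[]. Qed.

Section RealNorm.
Variables (R : realType) (k : scalars) (X : normedModType (scalar_field R k)).
Implicit Types (x y : X) (l : R).

Lemma norm_rnorm x : `|x| = of_real k (rnorm x).
Proof. by rewrite to_realK. Qed.

Lemma rnormZ l x : rnorm (of_real k l *: x) = `|l| * rnorm x.
Proof.
by rewrite {1}/rnorm normrZ norm_of_real norm_rnorm -of_realM of_realK.
Qed.

Lemma rnorm_ge0 x : 0 <= rnorm x.
Proof. exact: to_real_ge0. Qed.

Lemma rnorm0 : rnorm (0 : X) = 0.
Proof. by rewrite -(scale0r 0) -(of_real0 R) rnormZ normr0 mul0r. Qed.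

Lemma rnorm_gt0 x : x != 0 -> 0 < rnorm x.
Proof. by rewrite -(of_real_ltE k) -norm_rnorm of_real0 normr_gt0. Qed.

Lemma open_rnorm_lt1 : open [set x : X | rnorm x < 1].
Proof.
rewrite (_ : mkset _ = ball (0 : X) 1); first exact: ball_open.
apply/seteqP; split=> x; rewrite -ball_normE /ball_ /= sub0r normrN norm_rnorm;
  by rewrite -(of_real1 R) of_real_ltE.
Qed.

Lemma open_rnorm_gt1 : open [set x : X | 1 < rnorm x].
Proof.
rewrite openE => x; rewrite /= -(of_real_ltE k) of_real1 -norm_rnorm => x1.
apply/nbhs_ballP; exists (`|x| - 1); first by rewrite /= subr_gt0.
move=> y; rewrite -ball_normE /ball_ /= => xy.
rewrite -(of_real_ltE k) of_real1 -norm_rnorm.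
by have := le_lt_trans (lerB_dist _ _) xy; rewrite ltrD2l ltrN2.
Qed.

End RealNorm.

(** * Growth of the iterates and spectral radius *)

Section Iterates.
Variables (R : realType) (k : scalars) (X : normedModType (scalar_field R k)).
Variables (T : {linear X -> X}).
Implicit Types (x : X).

Lemma iter_scalable n a x : iter n T (a *: x) = a *: iter n T x.
Proof. by elim: n => //= n ->; rewrite linearZ. Qed.

Lemma rnorm_iter_scale (l : R) n x : 0 <= l ->
  rnorm (iter n (fun y => of_real k l *: T y) x) = l ^+ n * rnorm (iter n T x).
Proof.
move=> l0; suff -> : iter n (fun y => of_real k l *: T y) x =
    of_real k (l ^+ n) *: iter n T x by rewrite rnormZ ger0_norm ?exprn_ge0.
elim: n => /= [|n ->]; first by rewrite expr0 of_real1 scale1r.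
by rewrite linearZ scalerA -of_realM -exprS.
Qed.

Lemma rnorm_iter_le (M : R) n x : 0 <= M ->
  (forall y, rnorm (T y) <= M * rnorm y) ->
  rnorm (iter n T x) <= M ^+ n * rnorm x.
Proof.
move=> M0 TM; elim: n => /= [|n IHn]; first by rewrite mul1r.
by rewrite (le_trans (TM _))// exprS -mulrA ler_wpM2l.
Qed.

Hypothesis T_bounded : bounded_operator T.

Lemma bounded_operator_ge1 :
  exists2 M : R, 1 <= M & forall x, rnorm (T x) <= M * rnorm x.
Proof.
have [M TM] := T_bounded; exists (Num.max 1 M); first by rewrite le_max lexx.
move=> x; rewrite (le_trans (TM x))// ler_wpM2r ?rnorm_ge0//.
by rewrite le_max lexx orbT.
Qed.

Lemma opnorm_iterP n x :
  rnorm (iter n T x) <= opnorm (iter n T) * rnorm x.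
Proof.
have [M M1 TM] := bounded_operator_ge1.
have M0 : 0 <= M by rewrite (le_trans ler01).
have [->|x0] := eqVneq x 0.
  by rewrite -{1}(scale0r 0) iter_scalable scale0r rnorm0 mulr0.
have nx0 := rnorm_gt0 x0.
rewrite -ler_pdivrMr// mulrC -[X in X * _]ger0_norm ?invr_ge0 ?rnorm_ge0//.
rewrite -rnormZ -iter_scalable; apply: ub_le_sup.
  exists (M ^+ n) => _ [y /= y1 <-].
  by rewrite (le_trans (rnorm_iter_le n y M0 TM))// ler_piMr// exprn_ge0.
exists (of_real k (rnorm x)^-1 *: x) => //=.
by rewrite rnormZ ger0_norm ?invr_ge0 ?rnorm_ge0// mulVf ?gt_eqF.
Qed.

Lemma spectral_radius_ge0 : 0 <= spectral_radius T.
Proof.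
apply: lb_le_inf; first by exists (opnorm (iter 1 T) `^ 1%:R^-1), 1%N.
by move=> _ [n _ <-]; exact: powR_ge0.
Qed.

(** The infimum defining the spectral radius is approached by a single power,
    which bounds only the iterates whose exponent is a multiple of that power. *)
Lemma spectral_radius_lt (rho : R) : spectral_radius T < rho ->
  exists2 n, (0 < n)%N & forall x, rnorm (iter n T x) <= rho ^+ n * rnorm x.
Proof.
move=> r_lt; have rho0 := le_lt_trans spectral_radius_ge0 r_lt.
have [|_ [n /= n0 <-] n_lt] := inf_lt _ r_lt.
  by exists (opnorm (iter 1 T) `^ 1%:R^-1), 1%N.
exists n => // x; rewrite (le_trans (opnorm_iterP n x))//.
rewrite ler_wpM2r ?rnorm_ge0// leNgt; apply/negP => rho_lt.
have on0 : 0 <= opnorm (iter n T).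
  by rewrite (le_trans _ (ltW rho_lt))// exprn_ge0// ltW.
have : (opnorm (iter n T) `^ n%:R^-1) ^+ n < rho ^+ n.
  by rewrite ltr_pXn2r ?nnegrE ?powR_ge0 ?(ltW rho0).
rewrite -powR_mulrn ?powR_ge0// -powRrM mulVf ?pnatr_eq0 -?lt0n// powRr1//.
by rewrite ltNge (ltW rho_lt).
Qed.

(** Euclidean division of j by an exponent n for which the n-th power is
    bounded by rho^n: the quotient contributes powers of rho, and the remainder,
    being less than n, only the constant C. *)
Lemma spectral_radius_growth (rho : R) : spectral_radius T < rho ->
  exists2 C : R, 0 <= C & forall j x,
    rnorm (iter j T x) <= C * rho ^+ j * rnorm x.
Proof.
move=> r_lt; have rho0 := le_lt_trans spectral_radius_ge0 r_lt.
have [n n0 Tn] := spectral_radius_lt r_lt.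
have [M M1 TM] := bounded_operator_ge1.
(* A bounds one step after normalisation by rho; as 1 <= A, A ^+ n bounds
   any number of steps up to n. *)
pose A := Num.max 1 (M / rho).
have A1 : 1 <= A by rewrite le_max lexx.
have A0 : 0 <= A by rewrite (le_trans ler01).
exists (A ^+ n) => [|j]; first exact: exprn_ge0.
have [b] := ubnP j; elim: b j => // b IHb j; rewrite ltnS => jb x.
have [jn|nj] := ltnP j n.
  rewrite (le_trans (rnorm_iter_le j x (le_trans ler01 M1) TM))//.
  rewrite ler_wpM2r ?rnorm_ge0// -ler_pdivrMr ?exprn_gt0// -expr_div_n.
  rewrite (@le_trans _ _ (A ^+ j)) ?ler_weXn2l 1?ltnW//.
  rewrite lerXn2r ?nnegrE ?divr_ge0 ?(ltW rho0) ?(le_trans ler01)//.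
  by rewrite /A le_max lexx orbT.
rewrite -(subnK nj) iterD.
have jnb : (j - n < b)%N by lia.
rewrite (le_trans (IHb _ jnb _))// exprD -!mulrA ler_wpM2l ?exprn_ge0//.
by rewrite ler_wpM2l ?exprn_ge0// ltW.
Qed.

End Iterates.

(** * Sets of positive lower density *)

(** Gaps of such a set are at most proportional to their position. *)
Definition meets_geometric_windows (E : set nat) : Prop :=
  exists K N : nat, (0 < K)%N /\ forall n p, (N <= n)%N -> (p * K <= n)%N ->
    exists2 e, (p <= e <= n)%N & E e.

Lemma card_sub_interval (p n : nat) (P : pred 'I_n) :
  (forall i, P i -> (i < p)%N) -> (#|P| <= p)%N.
Proof.
move=> Pp; rewrite cardE -(size_map val) -[leqRHS](size_iota 0).
apply: uniq_leq_size; first by rewrite map_inj_uniq ?enum_uniq//; exact: val_inj.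
by move=> _ /mapP[j + ->]; rewrite mem_enum mem_iota => /Pp.
Qed.

(** If the proportion of E in [0, n] is at least d for all large n, then E has at
    least d (n + 1) elements there, whereas [0, p) contains only p integers: for
    p <= n / K with K > 1/d, some element of E must be at least p. *)
Lemma lower_density_gt0_visits (R : realType) (E : set nat) :
  0 < lower_density R E -> meets_geometric_windows E.
Proof.
rewrite /lower_density; set u := (X in limn_inf X) => ld0.
have u01 n : 0 <= u n <= 1.
  rewrite divr_ge0//= ler_pdivrMr ?ltr0n// mul1r ler_nat.
  by rewrite (leq_trans (max_card _))// card_ord.
have ubd : bounded_fun u.
  exists 1; split=> // M M1 n _; have /andP[un0 un1] := u01 n.
  by rewrite /= [`|u n|]ger0_norm// (le_trans un1)// ltW.
rewrite limn_infE// in ld0.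
have [|_ [N _ <-] dN] := sup_gt _ ld0; first by exists (infs u 0%N), 0%N.
set d := infs u N in dN.
have du n : (N <= n)%N -> d <= u n.
  move=> Nn; apply: ge_inf; last by exists n.
  by exists 0 => _ [m _ <-]; have /andP[] := u01 m.
exists (Num.trunc d^-1).+1, N; split=> // n p Nn pn.
apply: contrapT => noE.
have cp : (#|[pred i : 'I_n.+1 | (i : nat) \in E]| <= p)%N.
  apply: card_sub_interval => i /=; rewrite inE => Ei.
  rewrite ltnNge; apply/negP => pi; apply: noE; exists (i : nat) => //.
  by rewrite pi -ltnS ltn_ord.
have := du _ Nn; rewrite /u ler_pdivlMr ?ltr0n// => dn.
have : d * n.+1%:R <= p%:R by rewrite (le_trans dn)// ler_nat.
apply/negP; rewrite -ltNge.
have Kd : d^-1 < (Num.trunc d^-1).+1%:R := truncnS_gt _.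
move: (Num.trunc _).+1 pn Kd => K pn Kd.
rewrite -ltr_pdivrMl// (@le_lt_trans _ _ (p * K)%:R)//; last first.
  by rewrite ltr_nat ltnS.
by rewrite natrM mulrC ler_wpM2l// ltW.
Qed.

(** * Small and large times cannot be close *)

(** From a time m with u m < mu^-m, the growth hypothesis gives, for n <= L m,
    lam^n u n <= C q^(n - m) lam^m u m <= C (q^L lam / mu)^m, and the last
    quantity tends to 0. *)
Lemma no_close_visits (R : realType) (u : nat -> R) (C rho lam mu q : R)
    (L : nat) :
  (forall n, 0 <= u n) -> 0 <= C -> 0 <= rho -> 0 < lam ->
  1 <= q -> lam * rho <= q -> q ^+ L * lam < mu ->
  (forall m j, u (m + j)%N <= C * rho ^+ j * u m) ->
  exists M : nat, forall m n, (M <= m)%N -> (m <= n <= L * m)%N ->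
    mu ^+ m * u m < 1 -> lam ^+ n * u n <= 1.
Proof.
move=> u0 C0 rho0 lam0 q1 lrq qmu uC.
have q0 : 0 < q by rewrite (lt_le_trans ltr01).
have mu0 : 0 < mu by rewrite (le_lt_trans _ qmu)// mulr_ge0 ?exprn_ge0 ?ltW.
pose b := q ^+ L * lam / mu.
have b0 : 0 <= b by rewrite divr_ge0 ?mulr_ge0 ?exprn_ge0 ?ltW.
have b1 : `|b| < 1 by rewrite ger0_norm// ltr_pdivrMr ?mul1r.
have : C * b ^+ m @[m --> \oo] --> C * 0 by apply: cvgMr; exact: cvg_expr.
rewrite mulr0 => /cvgr_lt/(_ 1 ltr01)[M _ MC].
exists M => m n Mm /andP[mn nL] um.
have := MC m Mm => /= /ltW; apply: le_trans.
have mum0 : 0 < mu ^+ m by rewrite exprn_gt0.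
have um' : u m <= (mu ^+ m)^-1.
  by rewrite -[leRHS]mul1r ler_pdivlMr// mulrC ltW.
have -> : n = (m + (n - m))%N by rewrite subnKC.
set j := (n - m)%N; have jL : (j <= L * m)%N by rewrite /j (leq_trans (leq_subr _ _)).
rewrite (@le_trans _ _ (lam ^+ (m + j) * (C * rho ^+ j * u m)))//.
  by rewrite ler_wpM2l ?exprn_ge0 ?(ltW lam0).
have -> : lam ^+ (m + j) * (C * rho ^+ j * u m) =
    C * (lam * rho) ^+ j * lam ^+ m * u m by rewrite exprD exprMn; ring.
have -> : C * b ^+ m = C * q ^+ (L * m) * lam ^+ m * (mu ^+ m)^-1.
  by rewrite /b !exprMn exprVn -exprM; ring.
have lr0 : 0 <= lam * rho by rewrite mulr_ge0 ?(ltW lam0).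
apply: ler_pM => //.
- by rewrite !mulr_ge0 ?exprn_ge0 ?(ltW lam0).
- rewrite ler_wpM2r ?exprn_ge0 ?(ltW lam0)// ler_wpM2l//.
  rewrite (@le_trans _ _ (q ^+ j))//; last by rewrite ler_weXn2l.
  by rewrite lerXn2r ?nnegrE ?(ltW q0).
Qed.

(** * Visits of the orbit to the unit ball and to its exterior *)

Section Visits.
Variables (R : realType) (k : scalars) (X : normedModType (scalar_field R k)).
Variables (T : {linear X -> X}) (l : R) (x : X).
Hypothesis l0 : 0 < l.
Hypothesis FHCx : FHC R (fun y : X => of_real k l *: T y) x.

Lemma FHC_small_visits :
  meets_geometric_windows [set n | l ^+ n * rnorm (iter n T x) < 1].
Proof.
rewrite (_ : [set n | _] =
  [set n | rnorm (iter n (fun y => of_real k l *: T y) x) < 1]); last first.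
  by apply/funext => n; rewrite /mkset rnorm_iter_scale ?(ltW l0).
have := FHCx (@open_rnorm_lt1 R k X).
by move=> H; apply: (lower_density_gt0_visits (H _)); exists 0; rewrite /= rnorm0.
Qed.

Lemma FHC_large_visits : (exists y : X, y != 0) ->
  meets_geometric_windows [set n | 1 < l ^+ n * rnorm (iter n T x)].
Proof.
move=> [y y0].
rewrite (_ : [set n | _] =
  [set n | 1 < rnorm (iter n (fun y => of_real k l *: T y) x)]); last first.
  by apply/funext => n; rewrite /mkset rnorm_iter_scale ?(ltW l0).
have := FHCx (@open_rnorm_gt1 R k X).
move=> H; apply: (lower_density_gt0_visits (H _)).
exists (of_real k (2 / rnorm y) *: y); rewrite /= rnormZ.
have ny0 := rnorm_gt0 y0.
by rewrite ger0_norm ?divr_ge0 ?(ltW ny0)// divfK ?gt_eqF// ltr1n.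
Qed.

End Visits.

(** * Choice of the two multiples *)

Lemma exists_small_root (R : realType) (b : R) (L : nat) : 1 < b ->
  exists2 q : R, 1 < q & q ^+ L < b.
Proof.
move=> b1; have b0 : 0 <= b by rewrite (le_trans ler01)// ltW.
pose q := b `^ L.+1%:R^-1.
have q0 : 0 <= q := powR_ge0 _ _.
have qb : q ^+ L.+1 = b.
  by rewrite -powR_mulrn// -powRrM mulVf ?pnatr_eq0// powRr1.
have q1 : 1 < q.
  rewrite ltNge; apply/negP => q1; move: b1.
  by rewrite -qb ltNge exprn_ile1.
by exists q => //; rewrite -qb ltr_eXn2l.
Qed.

(** The hypothesis says that inf A * r <= 1 with the convention 1/0 = +oo, so
    points of A close to its infimum satisfy the strict inequality for q > 1. *)
Lemma exists_multiplier (R : realType) (A : set R) (r nu q : R) :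
  A !=set0 -> 0 <= r -> 1 < q ->
  ((inf A)%:E <= (r%:E)^-1)%E -> inf A < nu ->
  exists l, [/\ A l, l < nu & l * r < q].
Proof.
move=> A0 r0 q1; rewrite inver.
have [->|rN0] := eqVneq r 0.
  move=> _ /(inf_lt A0)[l Al lnu]; exists l; split=> //.
  by rewrite mulr0 (lt_trans ltr01).
have rgt0 : 0 < r by rewrite lt_neqAle eq_sym rN0.
rewrite lee_fin => infr infnu.
have [|l Al] := @inf_lt _ A (Num.min nu (q / r)) A0.
  rewrite lt_min infnu (le_lt_trans infr)// -[ltLHS]mul1r.
  by rewrite ltr_pM2r ?invr_gt0.
by rewrite lt_min ltr_pdivlMr// => /andP[? ?]; exists l.
Qed.

Section CommonVector.
Variables (R : realType) (k : scalars) (X : normedModType (scalar_field R k)).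
Variables (T : {linear X -> X}) (T_bounded : bounded_operator T).
Variables (Lambda : set R) (x : X).
Hypothesis X_nontrivial : exists y : X, y != 0.
Hypothesis Lambda_pos : forall l, Lambda l -> 0 < l.
Hypothesis FHCx : forall l, Lambda l ->
  FHC R (fun y : X => of_real k l *: T y) x.

(** Here lam is fixed first and mu last: a small time m is followed by a large
    time in [m, K m], with K independent of mu. *)
Lemma unbounded_no_common_FHC : Lambda !=set0 -> ~ has_ubound Lambda -> False.
Proof.
move=> [lam Ll] nub.
have lam0 := Lambda_pos Ll.
have [K [N [K0 KN]]] := FHC_large_visits lam0 (FHCx Ll) X_nontrivial.
have [M M1 TM] := bounded_operator_ge1 T_bounded.
have M0 : 0 <= M by rewrite (le_trans ler01).
pose q := Num.max 1 (lam * M).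
have [mu Lmu qmu] : exists2 mu, Lambda mu & q ^+ K * lam < mu.
  apply: contrapT => nmu; apply: nub; exists (q ^+ K * lam) => mu Lmu.
  by rewrite leNgt; apply/negP => qmu; apply: nmu; exists mu.
have [|||||||P PP] := @no_close_visits R (fun n => rnorm (iter n T x))
  1 M lam mu q K _ _ _ _ _ _ qmu _ => //.
- by move=> n; exact: rnorm_ge0.
- by rewrite le_max lexx.
- by rewrite le_max lexx orbT.
- by move=> m j; rewrite mul1r addnC iterD rnorm_iter_le.
have [K' [N' [K'0 KN']]] := FHC_small_visits (Lambda_pos Lmu) (FHCx Lmu).
have [||m /andP[Pm _] mum] := KN' (maxn N' (maxn P N * K')) (maxn P N);
  [exact: leq_maxl|exact: leq_maxr|].
have [||n mn] := KN (K * m)%N m; [|by rewrite mulnC|].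
  rewrite (@leq_trans m) ?leq_pmull// (leq_trans _ Pm)// leq_maxr//.
apply/negP; rewrite -leNgt; apply: PP mum => //.
by rewrite (leq_trans _ Pm)// leq_maxl.
Qed.

(** Here mu is fixed first and lam last: a large time n is preceded by a small
    time in [n / K, n], with K independent of lam. *)
Lemma inf_no_common_FHC :
  (exists l1 l2, [/\ Lambda l1, Lambda l2 & l1 != l2]) ->
  ((inf Lambda)%:E <= ((spectral_radius T)%:E)^-1)%E -> False.
Proof.
move=> two infr.
have Lambda0 : Lambda !=set0 by have [l [_ [Ll _ _]]] := two; exists l.
have lb0 : lbound Lambda 0 by move=> l /Lambda_pos/ltW.
have inf_ge0 : 0 <= inf Lambda by exact: lb_le_inf.
have [mu Lmu infmu] : exists2 mu, Lambda mu & inf Lambda < mu.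
  have infle l : Lambda l -> inf Lambda <= l by apply: ge_inf; exists 0.
  have [l1 [l2 [L1 L2]]] := two.
  rewrite neq_lt => /orP[l12|l21].
    by exists l2 => //; exact: le_lt_trans (infle _ L1) l12.
  by exists l1 => //; exact: le_lt_trans (infle _ L2) l21.
have mu0 := Lambda_pos Lmu.
have [K [N [K0 KN]]] := FHC_small_visits mu0 (FHCx Lmu).
pose nu := (inf Lambda + mu) / 2.
have nu0 : 0 < nu by rewrite /nu; lra.
have numu : 1 < mu / nu by rewrite ltr_pdivlMr// mul1r /nu; lra.
(* The factor 2 absorbs the rounding in n %/ K: a time m >= n %/ K only satisfies
   n < (m + 1) K <= 2 K m. *)
have [q q1 qb] := exists_small_root (2 * K) numu.
have infnu : inf Lambda < nu by rewrite /nu; lra.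
have [lam [Ll lamnu lamr]] := exists_multiplier Lambda0
  (spectral_radius_ge0 T) q1 infr infnu.
have lam0 := Lambda_pos Ll.
have q0 : 0 < q by rewrite (lt_trans ltr01).
have [|C C0 TC] := spectral_radius_growth T_bounded (_ : _ < q / lam).
  by rewrite ltr_pdivlMr// mulrC.
have [|||||P PP] := @no_close_visits R (fun n => rnorm (iter n T x))
  C (q / lam) lam mu q (2 * K) _ C0 _ lam0 (ltW q1) => //.
- by move=> n; exact: rnorm_ge0.
- by rewrite divr_ge0 ?ltW.
- by rewrite mulrC divfK ?gt_eqF.
- move: qb; rewrite ltr_pdivlMr// => /(le_lt_trans _); apply.
  by rewrite ler_wpM2l ?ltW ?exprn_gt0.
- by move=> m j; rewrite addnC iterD TC.
have [K' [N' [K'0 KN']]] := FHC_large_visits lam0 (FHCx Ll) X_nontrivial.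
(* The large time n must exceed N, for a small time to exist just before it,
   and (P + 1) K, for that small time to exceed P. *)
pose p0 := (maxn N (P.+1 * K))%N.
have [||n /andP[pn _]] := KN' (maxn N' (p0 * K')) p0;
  [exact: leq_maxl|exact: leq_maxr|].
apply/negP; rewrite -leNgt.
have [Nn Pn] : (N <= n)%N /\ (P.+1 * K <= n)%N.
  by split; rewrite (leq_trans _ pn)// /p0 ?leq_maxl ?leq_maxr.
have [||m /andP[pm mn] mum] := KN n (n %/ K)%N; [by []|exact: leq_trunc_div|].
have Pm : (P < m)%N by rewrite (leq_trans _ pm)// leq_divRL.
apply: PP mum; first exact: ltnW.
rewrite mn/=.
have := ltn_ceil n K0; nia.
Qed.

End CommonVector.

Theorem proposition2p5 (R : realType) (k : scalars)
    (X : completeNormedModType (scalar_field R k))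
    (X_nontrivial : exists x : X, x != 0)
    (T : {linear X -> X}) (T_bounded : bounded_operator T)
    (Lambda : set R)
    (Lambda_pos : forall l, Lambda l -> 0 < l)
    (Lambda_two : exists l1 l2, [/\ Lambda l1, Lambda l2 & l1 != l2])
    (Lambda_cond : ~ has_ubound Lambda \/
       ((inf Lambda)%:E <= ((spectral_radius T)%:E)^-1)%E) :
  \bigcap_(l in Lambda) FHC R (fun x : X => of_real k l *: T x) = set0.
Proof.
rewrite -subset0 => x FHCx; case: Lambda_cond => [nub|infr].
- apply: (unbounded_no_common_FHC T_bounded X_nontrivial Lambda_pos FHCx) => //.
  by have [l [_ [Ll _ _]]] := Lambda_two; exists l.
- exact: (inf_no_common_FHC T_bounded X_nontrivial Lambda_pos FHCx).
Qed.
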